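(* Let $\Psi=\{A_1,\dots,A_m\}\subset\mathbb{R}_+^{n\times n}$ be a finite nonempty set of SR-matrices. Then there exists $x\in\mathcal{D}_\Psi$ that is Pareto optimal for $e_{A_1},\dots,e_{A_m}$ with respect to $\operatorname{int}(\mathbb{R}^n_+)$.
   Context: $\mathbb{R}_+$ is the set of nonnegative reals and $\operatorname{int}(\mathbb{R}^n_+)$ is the set of $n$-tuples of positive reals. An SR-matrix (symmetrically reciprocal matrix) is a matrix $A$ with all entries positive, $a_{ii}=1$ for all $i$ and $a_{ij}a_{ji}=1$ for all $i\neq j$. For $A\in\mathbb{R}_+^{n\times n}$ and $x\in\operatorname{int}(\mathbb{R}^n_+)$, $e_A(x)=\max_{1\le i,j\le n}a_{ij}x_j/x_i$. Max-algebraic product: $(A\otimes B)_{ij}=\max_k a_{ik}b_{kj}$. $\mu(A)$ is the maximal cycle geometric mean: the maximum of $(a_{i_1i_2}\cdots a_{i_ki_1})^{1/k}$ over all $k\ge 1$ and all sequences of distinct indices $i_1,\dots,i_k$. For $p\ge1$, $\Psi_\otimes^p=\{A_{j_1}\otimes\cdots\otimes A_{j_p}: 1\le j_k\le m\}$, and $\hat\mu(\Psi)=\limsup_{p\to\infty}\left(\max_{\psi\in\Psi_\otimes^p}\mu(\psi)\right)^{1/p}$ (max version of the generalised spectral radius). $\mathcal{C}_\Psi=\{x\in\operatorname{int}(\mathbb{R}^n_+)\mid e_{A_i}(x)\le\hat\mu(\Psi)\text{ for all }i\}$ and $\mathcal{D}_\Psi=\{x\in\mathcal{C}_\Psi\mid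 x_1=1\}$. For a set $E\subseteq\operatorname{int}(\mathbb{R}^n_+)$, a point $w\in E$ is Pareto optimal for $e_{A_1},\dots,e_{A_m}$ with respect to $E$ if, for every $x\in E$, $e_{A_i}(x)\le e_{A_i}(w)$ for all $i$ implies $e_{A_i}(x)=e_{A_i}(w)$ for all $i$. *)

(* Defs.v *)
From mathcomp Require Import all_boot all_order all_algebra.
From mathcomp Require Import all_classical all_reals all_analysis.

Set Implicit Arguments.
Unset Strict Implicit.
Unset Printing Implicit Defensive.

Import Order.TTheory GRing.Theory Num.Theory.

Local Open Scope classical_set_scope.
Local Open Scope ring_scope.

(* The matrices of interest have nonnegative entries, so an iterated Num.max
   starting from 0 over a nonempty finite range is the maximum. *)

Definition int_Rplus (R : realType) (n : nat) : set 'cV[R]_n :=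
  [set x | forall i, 0 < x i 0].

Definition SR_matrix (R : realType) (n : nat) (A : 'M[R]_n) : Prop :=
  [/\ forall i j, 0 < A i j,
      forall i, A i i = 1
    & forall i j, i != j -> A i j * A j i = 1].

Definition max_err (R : realType) (n : nat) (A : 'M[R]_n) (x : 'cV[R]_n) : R :=
  \big[Num.max/0]_i \big[Num.max/0]_j (A i j * x j 0 / x i 0).

Definition max_mulmx (R : realType) (m n p : nat)
    (A : 'M[R]_(m, n)) (B : 'M[R]_(n, p)) : 'M[R]_(m, p) :=
  \matrix_(i, j) \big[Num.max/0]_k (A i k * B k j).

(* ordS is the cyclic successor, so the last factor closes the cycle; distinct
   indices force k <= n. *)
Definition max_cycle_mean (R : realType) (n : nat) (A : 'M[R]_n) : R :=
  \big[Num.max/0]_(1 <= k < n.+1) \big[Num.max/0]_(s : k.-tuple 'I_n | uniq s)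
    (\prod_(t < k) A (tnth s t) (tnth s (ordS t))) `^ k%:R^-1.

(* 1%:M is the neutral element of max_mulmx on nonnegative matrices. *)
Definition max_word (R : realType) (n m : nat) (A : 'I_m -> 'M[R]_n)
    (p : nat) (j : p.-tuple 'I_m) : 'M[R]_n :=
  \big[@max_mulmx R n n n/1%:M]_(k < p) A (tnth j k).

Definition max_words (R : realType) (n m : nat) (A : 'I_m -> 'M[R]_n)
    (p : nat) : set 'M[R]_n :=
  [set max_word A j | j in [set: p.-tuple 'I_m]].

(* max_words A p is finite and nonempty when 0 < m, so the supremum is a
   maximum.  The sequence is bounded by the largest entry of the matrices (and
   1), so limn_sup is the true limit superior; the term p = 0 is immaterial. *)
Definition max_gen_spectral_radius (R : realType) (n m : nat)
    (A : 'I_m -> 'M[R]_n) : R :=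
  limn_sup (fun p : nat =>
    sup [set max_cycle_mean B | B in max_words A p] `^ p%:R^-1).

Definition C_set (R : realType) (n m : nat) (A : 'I_m -> 'M[R]_n)
    : set 'cV[R]_n :=
  [set x | int_Rplus x /\
           forall i, max_err (A i) x <= max_gen_spectral_radius A].

Definition D_set (R : realType) (n m : nat) (A : 'I_m -> 'M[R]_n.+1)
    : set 'cV[R]_n.+1 :=
  [set x | C_set A x /\ x ord0 0 = 1].

Definition pareto_optimal (R : realType) (T : Type) (m : nat)
    (f : 'I_m -> T -> R) (E : set T) (w : T) : Prop :=
  E w /\ forall x, E x -> (forall i, f i x <= f i w) ->
                   forall i, f i x = f i w.

(* Main.v *)
(* Write lambda for the generalised spectral radius. A diagonal entry w of a
   word B of length p satisfies w <= lambda ^ p, because the powers of B are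
   words of length p * q whose diagonal entry is at least w ^ q. Since all
   entries are positive, every walk can be closed at bounded cost, so the
   entries of words of length p are O(lambda ^ p), and x_i = sup over words B of
   B_{i0} / lambda ^ (length of B) is a positive vector in C_set. The normalised
   set D_set is compact, and a minimiser of the sum of the errors over it is
   Pareto optimal: an x that dominates it lies in C_set, hence after scaling in
   D_set, with a sum of errors that cannot be smaller. *)
Require Import Defs.
From mathcomp Require Import all_boot all_order all_algebra.
From mathcomp Require Import all_classical all_reals all_analysis.

Set Implicit Arguments.
Unset Strict Implicit.
Unset Printing Implicit Defensive.

Import Order.TTheory GRing.Theory Num.Theory.
Import numFieldNormedType.Exports.

Local Open Scope classical_set_scope.
Local Open Scope ring_scope.

(** * Limit superior and roots of nonnegative reals *)

Lemma limn_sup_ge_frequently (R : realType) (u : nat -> R) (c M : R) :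
  (forall k, 0 <= u k <= M) ->
  (forall N, exists2 k, (N <= k)%N & c <= u k) -> c <= limn_sup u.
Proof.
move=> uM uc.
have bu : bounded_fun u.
  exists M; split; first by rewrite num_real.
  move=> x /ltW Mx k _ /=; have /andP[u0 ukM] := uM k.
  by rewrite ger0_norm// (le_trans ukM).
(* The limit superior is the infimum of the tail suprema, and every tail contains a term at least
   [c]. *)
rewrite limn_supE//; apply: lb_le_inf; first by exists (sups u 0%N), 0%N.
move=> _ [N _ <-]; have [k Nk ck] := uc N.
apply: (le_trans ck); apply: ub_le_sup; last by exists k.
by exists M => _ [j _ <-]; have /andP[] := uM j.
Qed.

Lemma powR_exprK (R : realType) (a : R) (p : nat) :
  0 <= a -> (0 < p)%N -> (a ^+ p) `^ p%:R^-1 = a.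
Proof.
move=> a0 p0; rewrite -powR_mulrn// -powRrM mulfV ?powRr1//.
by rewrite pnatr_eq0 -lt0n.
Qed.

Lemma powR_invK (R : realType) (a : R) (p : nat) :
  0 <= a -> (0 < p)%N -> (a `^ p%:R^-1) ^+ p = a.
Proof.
move=> a0 p0; rewrite -powR_mulrn ?powR_ge0// -powRrM mulVf ?powRr1//.
by rewrite pnatr_eq0 -lt0n.
Qed.

(** * Bounds for the maximal cycle geometric mean *)

Section MaxCycleMean.
Variables (R : realType) (n : nat) (B : 'M[R]_n).

Lemma diag_le_max_cycle_mean (i : 'I_n) :
  0 <= B i i -> B i i <= max_cycle_mean B.
Proof.
move=> Bii0; have n0 : (1 < n.+1)%N.
  by rewrite ltnS (leq_ltn_trans _ (ltn_ord i)).
(* The loop at [i] is a cycle of length 1, so the term [k = 1] suffices. *)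
rewrite /max_cycle_mean big_ltn// le_max; apply/orP; left.
apply: (bigmax_sup [tuple i]) => //.
by rewrite big_ord1 invr1 powRr1 !(tnth_nth i) /= ?ord1.
Qed.

Lemma max_cycle_mean_le (c : R) : 0 <= c ->
  (forall i j, 0 <= B i j <= c) -> max_cycle_mean B <= c.
Proof.
move=> c0 Bc; rewrite /max_cycle_mean big_seq.
apply: bigmax_le => // k; rewrite mem_index_iota => /andP[k0 _].
apply: bigmax_le => // s _; rewrite -[leRHS](powR_exprK c0 k0).
rewrite ge0_ler_powR ?invr_ge0 ?nnegrE ?exprn_ge0//.
  by apply: prodr_ge0 => t _; have /andP[] := Bc (tnth s t) (tnth s (ordS t)).
rewrite -[X in c ^+ X](card_ord k) -prodr_const.
by apply: ler_prod => t _; exact: Bc.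
Qed.

End MaxCycleMean.

(** * Max-algebraic words and their diagonal entries *)

Section Words.
Variables (R : realType) (n m : nat) (A : 'I_m -> 'M[R]_n).
Hypothesis A_ge0 : forall k i j, 0 <= A k i j.

(** Indexing by sequences lets words be concatenated and repeated without casts between tuple
    lengths. *)
Definition seq_word (s : seq 'I_m) : 'M[R]_n :=
  \big[@max_mulmx R n n n/1%:M]_(k <- s) A k.

Lemma seq_word_max_words (s : seq 'I_m) : max_words A (size s) (seq_word s).
Proof.
exists (in_tuple s) => //; exact/esym/(big_tuple _ _ (in_tuple s)).
Qed.

Lemma max_words_seq_word (p : nat) (B : 'M[R]_n) :
  max_words A p B -> exists2 s, size s = p & B = seq_word s.
Proof.
move=> [t _ <-]; exists t; first exact: size_tuple.
by rewrite /seq_word big_tuple.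
Qed.

Lemma seq_word_cons (k : 'I_m) (s : seq 'I_m) :
  seq_word (k :: s) = max_mulmx (A k) (seq_word s).
Proof. by rewrite /seq_word big_cons. Qed.

Lemma seq_word_ge0 (s : seq 'I_m) i j : 0 <= seq_word s i j.
Proof.
case: s => [|k s]; first by rewrite /seq_word big_nil mxE ler0n.
by rewrite seq_word_cons mxE bigmax_ge_id.
Qed.

Lemma seq_word_cons_ge (k : 'I_m) (s : seq 'I_m) i l j :
  A k i l * seq_word s l j <= seq_word (k :: s) i j.
Proof. by rewrite seq_word_cons mxE; exact: le_bigmax. Qed.

(** An entry of a word is the largest weight of a walk that follows its letters; a walk along [s] to
    [l] continues along [t]. *)
Lemma seq_word_cat_ge (s t : seq 'I_m) i l j :
  seq_word s i l * seq_word t l j <= seq_word (s ++ t) i j.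
Proof.
elim: s i => [|k s IH] i /=.
  rewrite [seq_word [::]]/seq_word big_nil mxE.
  by case: eqP => [->|_]; rewrite ?mul1r ?mul0r ?seq_word_ge0.
rewrite (seq_word_cons k s) mxE.
have [->|t0] := eqVneq (seq_word t l j) 0.
  by rewrite mulr0 seq_word_ge0.
have {}t0 : 0 < seq_word t l j by rewrite lt_neqAle eq_sym t0 seq_word_ge0.
rewrite -ler_pdivlMr//; apply: bigmax_le => [|h _].
  by rewrite divr_ge0 ?seq_word_ge0.
rewrite ler_pdivlMr// -mulrA; apply: le_trans (seq_word_cons_ge _ _ _ h _).
by rewrite ler_wpM2l.
Qed.

Lemma seq_word_le (M : R) (s : seq 'I_m) i j : 1 <= M ->
  (forall k i j, A k i j <= M) -> seq_word s i j <= M ^+ size s.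
Proof.
move=> M1 AM; have M0 : 0 <= M by rewrite (le_trans ler01).
elim: s i => [|k s IH] i /=.
  by rewrite /seq_word big_nil mxE expr0 lern1 leq_b1.
rewrite seq_word_cons mxE; apply: bigmax_le => [|h _]; first exact: exprn_ge0.
by rewrite exprS ler_pM ?seq_word_ge0.
Qed.

Lemma seq_word_diag_exp (s : seq 'I_m) (q : nat) i :
  seq_word s i i ^+ q <= seq_word (flatten (nseq q s)) i i.
Proof.
elim: q => [|q IH] /=.
  by rewrite /seq_word big_nil mxE eqxx expr0.
rewrite exprS; apply: le_trans (seq_word_cat_ge _ _ _ i _).
by rewrite ler_wpM2l ?seq_word_ge0.
Qed.

Lemma seq_word_diag_le (s : seq 'I_m) i : (0 < size s)%N ->
  seq_word s i i <= max_gen_spectral_radius A ^+ size s.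
Proof.
move=> s0; set w := seq_word s i i; have w0 : 0 <= w by exact: seq_word_ge0.
(* The default value 1 gives [1 <= M], so that [M ^+ p] also bounds the entries of the empty word,
   the identity. *)
pose M := \big[Num.max/1]_k \big[Num.max/1]_i \big[Num.max/1]_j A k i j.
have M1 : 1 <= M by exact: bigmax_ge_id.
have M0 : 0 <= M by rewrite (le_trans ler01).
have AM k i' j : A k i' j <= M.
  apply: (bigmax_sup k) => //; apply: (bigmax_sup i') => //.
  exact: le_bigmax.
pose S p := [set max_cycle_mean B | B in max_words A p].
have SM p : ubound (S p) (M ^+ p).
  move=> _ [_ /max_words_seq_word[t <- ->] <-].
  apply: max_cycle_mean_le => [|h l].
    exact: exprn_ge0.
  by rewrite seq_word_ge0 seq_word_le.
have S0 p t : size t = p -> S p (max_cycle_mean (seq_word t)).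
  by move=> <-; exists (seq_word t) => //; exact: seq_word_max_words.
have seqs_ne p : exists t : seq 'I_m, size t = p.
  (* The alphabet may be empty in this section; a letter is taken from the nonempty [s]. *)
  case: s s0 {w w0} => // k _ _; exists (nseq p k); exact: size_nseq.
have S_ge0 p : 0 <= sup (S p).
  have [t tp] := seqs_ne p.
  by apply: le_trans (ub_le_sup _ (S0 _ _ tp));
    [exact: bigmax_ge_id|exists (M ^+ p)].
suff wl : w `^ (size s)%:R^-1 <= max_gen_spectral_radius A.
  rewrite -[leLHS](powR_invK w0 s0) lerXn2r ?nnegrE ?powR_ge0//.
  exact: le_trans (powR_ge0 _ _) wl.
apply: (@limn_sup_ge_frequently _ _ _ M) => [p|N].
  rewrite powR_ge0/=; have [t tp] := seqs_ne p.
  (* At [p = 0] the exponent is [0^-1 = 0], so the term is 1, which is at most [M]. *)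
  have [->|p0] := posnP p; first by rewrite invr0 powRr0.
  rewrite -[leRHS](powR_exprK M0 p0)
    ge0_ler_powR ?invr_ge0 ?nnegrE ?exprn_ge0 ?S_ge0//.
  apply: ge_sup; last exact: SM.
  by exists (max_cycle_mean (seq_word t)); exact: S0.
(* Repeating [s] gives arbitrarily long words whose roots all stay above the same number
   [w ^ (1 / size s)]. *)
exists (N.+1 * size s)%N; first by rewrite (leq_trans (leqnSn _))// leq_pmulr.
have sz : size (flatten (nseq N.+1 s)) = (N.+1 * size s)%N.
  by rewrite size_flatten /shape map_nseq sumn_nseq mulnC.
have -> : w `^ (size s)%:R^-1 = (w ^+ N.+1) `^ (N.+1 * size s)%:R^-1.
  by rewrite -powR_mulrn// -powRrM natrM invfM mulrA mulfV ?mul1r//.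
rewrite ge0_ler_powR ?invr_ge0 ?nnegrE ?exprn_ge0 ?S_ge0//.
apply: le_trans (seq_word_diag_exp _ _ _) _.
apply: le_trans (diag_le_max_cycle_mean _) _; first exact: seq_word_ge0.
by apply: ub_le_sup; [exists (M ^+ (N.+1 * size s)); exact: SM|exact: S0].
Qed.

End Words.

(** * Subeigenvector form, scaling and continuity of the error *)

Section MaxErr.
Variables (R : realType) (n : nat).
Implicit Types (A : 'M[R]_n) (x : 'cV[R]_n).

Lemma max_err_leP A x (c : R) : int_Rplus x -> 0 <= c ->
  max_err A x <= c <-> forall i j, A i j * x j 0 <= c * x i 0.
Proof.
move=> x0 c0; split=> [xc i j|xc].
  rewrite -ler_pdivrMr//; apply: le_trans xc.
  by apply: (bigmax_sup i) => //; exact: le_bigmax.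
apply: bigmax_le => // i _; apply: bigmax_le => // j _.
by rewrite ler_pdivrMr.
Qed.

Lemma max_errZ A x (c : R) : c != 0 -> max_err A (c *: x) = max_err A x.
Proof.
move=> c0; apply: eq_bigr => i _; apply: eq_bigr => j _.
by rewrite !mxE mulrCA -mulf_div mulfV// mul1r.
Qed.

(** A finite maximum of quotients of coordinates. Row vectors are used to match the compactness and
    extreme value theorems applied below. *)
Lemma continuous_max_err A (v : 'rV[R]_n) : (forall i, v 0 i != 0) ->
  {for v, continuous (fun w : 'rV[R]_n => max_err A w^T)}.
Proof.
move=> v0.
have max_cont : continuous (fun z : R * R => Num.max z.1 z.2).
  move=> z; apply: (@continuous_max _ _ fst snd);
    [exact: cvg_fst|exact: cvg_snd].
rewrite /prop_for /continuous_at /max_err.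
have nbhsF : Filter (nbhs v) by exact: nbhs_filter.
apply: (@cvg_big _ _ _ _ _ max_cont _ (nbhs v)) => i _.
apply: (@cvg_big _ _ _ _ _ max_cont _ (nbhs v)) => j _.
have cvg_coord k : w^T k 0 @[w --> v] --> v^T k 0.
  rewrite mxE; under eq_fun do rewrite mxE.
  exact: coord_continuous.
apply: cvgM; first by apply: cvgM; [exact: cvg_cst|exact: cvg_coord].
by apply: cvgV; [rewrite mxE|exact: cvg_coord].
Qed.

End MaxErr.

(** * Nonemptiness, compactness and the minimiser *)

Section Pareto.
Variables (R : realType) (n m : nat) (A : 'I_m.+1 -> 'M[R]_n.+1).
Hypothesis A_gt0 : forall k i j, 0 < A k i j.

Local Notation lambda := (max_gen_spectral_radius A).

Let A_ge0 k i j : 0 <= A k i j. Proof. exact: ltW. Qed.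

Lemma max_gen_spectral_radius_gt0 : 0 < lambda.
Proof.
have := seq_word_diag_le A_ge0 (s := [:: ord0]) ord0 erefl.
rewrite expr1; apply: lt_le_trans.
apply: lt_le_trans (seq_word_cons_ge A _ _ _ ord0 _).
by rewrite /seq_word big_nil mxE eqxx mulr1.
Qed.

Let lambda_gt0 := max_gen_spectral_radius_gt0.

Lemma C_set_nonempty : C_set A !=set0.
Proof.
pose E i := [set seq_word A s i 0 / lambda ^+ size s | s in [set: seq 'I_m.+1]].
have E_ub i : has_ubound (E i).
  (* A step from index 0 to [i] by the letter [ord0] closes a walk from [i] to 0 into a cycle at 0,
     of one letter more. *)
  exists (lambda / A ord0 ord0 i) => _ [s _ <-].
  rewrite ler_pdivrMr ?exprn_gt0// mulrAC ler_pdivlMr// mulrC -exprS.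
  apply: le_trans (seq_word_diag_le A_ge0 (s := ord0 :: s) ord0 erefl).
  exact: seq_word_cons_ge.
have E_le i s : seq_word A s i 0 / lambda ^+ size s <= sup (E i).
  by apply: ub_le_sup => //; exists s.
exists (\col_i sup (E i)).
have x_gt0 : int_Rplus (\col_i sup (E i)).
  (* A one-letter word is taken because the empty word has zero entries off the diagonal. *)
  move=> i; rewrite mxE; apply: lt_le_trans (E_le i [:: ord0]).
  rewrite divr_gt0 ?exprn_gt0//.
  apply: lt_le_trans (seq_word_cons_ge A _ _ _ ord0 _).
  by rewrite /seq_word big_nil mxE eqxx mulr1.
split=> // k; apply/max_err_leP; rewrite ?ltW// => i j; rewrite !mxE.
rewrite mulrC -ler_pdivlMr//; apply: ge_sup.
  by exists (seq_word A [::] j 0 / lambda ^+ 0), [::].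
move=> _ [s _ <-]; rewrite ler_pdivlMr// mulrC [leRHS]mulrC -ler_pdivrMr//.
(* Prepending the letter [k] to [s] costs one further factor [lambda]. *)
apply: le_trans (E_le i (k :: s)).
rewrite exprSr invfM !mulrA !ler_wpM2r ?invr_ge0 ?exprn_ge0 ?(ltW lambda_gt0)//.
exact: seq_word_cons_ge.
Qed.

Lemma D_set_normalize x : C_set A x -> D_set A ((x ord0 0)^-1 *: x).
Proof.
move=> [x0 xl]; split; last by rewrite mxE mulVf ?gt_eqF.
split=> [i|k]; first by rewrite mxE mulr_gt0 ?invr_gt0.
by rewrite max_errZ ?invr_eq0 ?gt_eqF.
Qed.

Lemma compact_D_set : compact [set v : 'rV[R]_n.+1 | D_set A v^T].
Proof.
(* The box comes from the inequalities of the letter [ord0] between index 0, where the coordinate is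
   1, and [i]. Its positive lower bounds keep limits inside the open cone. *)
pose K := [set v : 'rV[R]_n.+1 |
  forall i, `[A ord0 i ord0 / lambda, lambda / A ord0 ord0 i]%classic (v 0 i)].
pose F (kij : 'I_m.+1 * ('I_n.+1 * 'I_n.+1)) := [set v : 'rV[R]_n.+1 |
  A kij.1 kij.2.1 kij.2.2 * v 0 kij.2.2 - lambda * v 0 kij.2.1 <= 0].
pose N := [set v : 'rV[R]_n.+1 | v 0 ord0 = 1].
have K_compact : compact K.
  apply: (@rV_compact R _
    (fun i => `[A ord0 i ord0 / lambda, lambda / A ord0 ord0 i]%classic)) => i.
  exact: segment_compact.
have F_closed t : closed (F t).
  apply: (@preimage_closed _ _ (fun v : 'rV[R]_n.+1 =>
    A t.1 t.2.1 t.2.2 * v 0 t.2.2 - lambda * v 0 t.2.1) [set y | y <= 0]);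
    last exact: closed_le.
  have cont_mul c l : continuous (fun v : 'rV[R]_n.+1 => c * v 0 l).
    by move=> v; apply: continuousM;
      [exact: cst_continuous|exact: coord_continuous].
  by move=> v _; exact: (continuousB (@cont_mul _ _ v) (@cont_mul _ _ v)).
have N_closed : closed N.
  apply: (@preimage_closed _ _ _ [set y : R | y = 1]); last exact: closed_eq.
  by move=> v _; exact: coord_continuous.
suff -> : [set v | D_set A v^T] = K `&` (\bigcap_t F t `&` N).
  by apply: compact_closedI => //; apply: closedI => //; exact: closed_bigI.
have l0 := ltW lambda_gt0.
apply/seteqP; split=> v /=.
  move=> [[v0 /= vl] v1]; have {}vl k i j : A k i j * v 0 j <= lambda * v 0 i.
    by have /max_err_leP-/(_ v0 l0 i j) := vl k; rewrite !mxE.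
  have {}v1 : v 0 ord0 = 1 by rewrite -v1 mxE.
  split; last first.
    by split=> // -[k [i j]] _ /=; rewrite /F /= subr_le0.
  move=> i /=; rewrite in_itv/= ler_pdivrMr// ler_pdivlMr//.
  have := vl ord0 i ord0; have := vl ord0 ord0 i; rewrite v1 !mulr1.
  by rewrite ![v 0 i * _]mulrC => -> ->.
move=> [Kv [Fv Nv]]; have v0 : int_Rplus v^T.
  move=> i; rewrite mxE; have := Kv i; rewrite /= in_itv/= => /andP[+ _].
  by apply: lt_le_trans; rewrite divr_gt0.
split; last by rewrite mxE.
split=> // k; apply/max_err_leP => // i j; rewrite !mxE.
by have := Fv (k, (i, j)) I; rewrite /F/= subr_le0.
Qed.

Lemma exists_D_set_pareto_optimal : exists x : 'cV[R]_n.+1,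
  D_set A x /\ pareto_optimal (fun k => max_err (A k)) (@int_Rplus R n.+1) x.
Proof.
pose f (v : 'rV[R]_n.+1) := \sum_k max_err (A k) v^T.
pose K := [set v : 'rV[R]_n.+1 | D_set A v^T].
have K0 : K !=set0.
  have [x /D_set_normalize Dx] := C_set_nonempty.
  by exists ((x ord0 0)^-1 *: x)^T; rewrite /K /= trmxK.
have f_cont : {within K, continuous f}.
  apply: continuous_in_subspaceT => v; rewrite inE => -[[v0 _] _].
  have add_cont : continuous (fun z : R * R => z.1 + z.2).
    exact: add_continuous.
  have nbhsF : Filter (nbhs v) by exact: nbhs_filter.
  rewrite /continuous_at /f.
  apply: (@cvg_big _ _ _ _ _ add_cont _ (nbhs v)) => k _.
  apply: continuous_max_err => i.
  by have := v0 i; rewrite mxE => /gt_eqF ->.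
have [v + v_min] := EVT_min_rV K0 compact_D_set f_cont.
rewrite inE => Dv; exists v^T; split=> //; split; first by have [[]] := Dv.
have [[v0 vl] _] := Dv.
move=> x x0 xv.
have Dx : D_set A ((x ord0 0)^-1 *: x).
  by apply: D_set_normalize; split=> // k; exact: le_trans (xv k) (vl k).
have : f v <= f ((x ord0 0)^-1 *: x)^T.
  by apply: v_min; rewrite inE /K /= trmxK.
rewrite /f trmxK; under [leRHS]eq_bigr do rewrite max_errZ ?invr_eq0 ?gt_eqF//.
(* A strict gain at [k], with no loss elsewhere, would make the sum of errors smaller than its
   minimum. *)
move=> vx k; apply/eqP; rewrite eq_le xv /= leNgt; apply/negP => xvk.
move: vx; rewrite leNgt => /negP; apply.
rewrite (bigD1 k)//= [ltRHS](bigD1 k)//= ltr_leD//.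
by apply: ler_sum => l _.
Qed.

End Pareto.

Theorem corollary5p2 (R : realType) (n m : nat)
    (A : 'I_m.+1 -> 'M[R]_n.+1)
    (hA : forall i, SR_matrix (A i)) :
  exists x : 'cV[R]_n.+1,
    D_set A x /\
    pareto_optimal (fun i => max_err (A i)) (@int_Rplus R n.+1) x.
Proof. by apply: exists_D_set_pareto_optimal => k i j; have [] := hA k. Qed.
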